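(* Let $f,g\colon[0,1]\to[0,\infty)$ be continuous essentially increasing functions such that $\mathbf{E}_f$ and $\mathbf{E}_g$ are equivalence relations. Suppose there exists a function $\kappa\colon\{1/2^{i}\colon i<\omega\}\to[0,1]$ satisfying $$f(1)=g(\kappa(1)),\qquad f(1/2^{n})=\sum_{i=0}^{n}g\big(\kappa(1/2^{i})/2^{n-i}\big)\quad(0<n<\omega),$$ and such that for some $L\ge1$, $$\sum_{i=n}^{\infty}g(\kappa(1/2^{i}))\le L\sum_{i=0}^{n}g\big(\kappa(1/2^{i})/2^{n-i}\big)\quad(n<\omega)$$ and $$\kappa(1/2^{n})\le L\cdot\max\{\kappa(1/2^{i})/2^{n-i}\colon i<n\}\quad(0<n<\omega).$$ Then $\mathbf{E}_f\le_B\mathbf{E}_g$.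
   Context: For $f\colon[0,1]\to[0,\infty)$, $\mathbf{E}_f$ is the relation on $[0,1]^{\omega}$ given by $(x_n)\,\mathbf{E}_f\,(y_n)\iff\sum_{n<\omega}f(|y_n-x_n|)<\infty$. A function $f\colon[0,1]\to[0,\infty)$ is essentially increasing if there is $C\ge1$ such that $x\le y$ implies $f(x)\le Cf(y)$ for all $x,y\in[0,1]$. For equivalence relations $E$ on a Polish space $X$ and $F$ on a Polish space $Y$, $E\le_B F$ means there is a Borel function $\vartheta\colon X\to Y$ with $x\,E\,x'\iff\vartheta(x)\,F\,\vartheta(x')$ for all $x,x'\in X$. *)

(* Defs.v *)
From mathcomp Require Import all_boot all_order all_algebra.
From mathcomp Require Import all_classical all_reals all_analysis.
From Stdlib Require Export RelationClasses.

Set Implicit Arguments.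
Unset Strict Implicit.
Unset Printing Implicit Defensive.

Import Order.TTheory GRing.Theory Num.Theory.
Import numFieldNormedType.Exports.

Local Open Scope classical_set_scope.
Local Open Scope ring_scope.

(* Throughout, a function [0,1] -> [0,oo[ is given by some f : R -> R of which
   only the values on [0,1] are ever used. *)

Definition essentially_increasing (R : realType) (f : R -> R) : Prop :=
  exists2 C : R, 1 <= C &
    {in `[0, 1] &, forall x y : R, x <= y -> f x <= C * f y}.

(* [0,1]^omega: the unit interval carries the subspace topology (set_type),
   the power the product topology. *)
Definition unit_cube (R : realType) : topologicalType :=
  prod_topology (fun _ : nat => set_type (`[0, 1] : set R)).

Definition Erel (R : realType) (f : R -> R) (x y : unit_cube R) : Prop :=
  (\sum_(0 <= n <oo) (f `|set_val (y n) - set_val (x n)|)%:E < +oo)%E.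

Definition borel_fun (X Y : topologicalType) (h : X -> Y) : Prop :=
  forall B : set Y, <<s open >> B -> <<s open >> (h @^-1` B).

(* Only meaningful for equivalence relations E, F on Polish spaces X, Y. *)
Definition borel_reducible (X Y : topologicalType)
    (E : X -> X -> Prop) (F : Y -> Y -> Prop) : Prop :=
  exists2 h : X -> Y, borel_fun h & forall x x' : X, E x x' <-> F (h x) (h x').

(* Main.v *)
(* Send each coordinate u of x to the sequence of coordinates
   kappa(2^-i) (1 + cos(2^i u)) / 2 and kappa(2^-i) (1 + sin(2^i u)) / 2, i < omega.
   If |u - v| is about 2^-n, the terms with i <= n move by about kappa(2^-i) / 2^(n-i):
   at most, because sin and cos are Lipschitz, and at least, because one of sin and cos
   must move by half the (short) arc. The terms with i > n move by at most kappa(2^-i).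
   Hence the g-sum of the moves is comparable to f |u - v|, given that f and g are
   doubling, which follows from the transitivity of E_f and E_g. *)
Require Import Defs.
From mathcomp Require Import all_boot all_order all_algebra.
From mathcomp Require Import all_classical all_reals all_analysis.
From mathcomp Require Import ring lra.
Import Order.TTheory GRing.Theory Num.Theory.
Import numFieldNormedType.Exports.
Local Open Scope classical_set_scope.
Local Open Scope ring_scope.

Set Implicit Arguments.
Unset Strict Implicit.

(** * Rearrangement of double series *)

Lemma nneseries_pair (R : realType) (e : nat -> nat * nat)
    (a : nat -> nat -> \bar R) :
  set_bij [set: nat] [set: nat * nat] e -> (forall n i, (0 <= a n i)%E) ->
  (\sum_(0 <= m <oo) a (e m).1 (e m).2 =
   \sum_(0 <= n <oo) \sum_(0 <= i <oo) a n i)%E.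
Proof.
move=> e_bij a_ge0.
rewrite nneseries_esumT// -(@reindex_esum _ _ _ _ _ _ (fun k => a k.1 k.2) e_bij).
rewrite nneseries_esumT; last by move=> n; exact: nneseries_ge0.
under [RHS]eq_esum do rewrite nneseries_esumT//.
by rewrite esum_esum//; congr esum; apply/seteqP; split.
Qed.

Lemma nat2_bij : exists e : nat -> nat * nat,
  set_bij [set: nat] [set: nat * nat] e.
Proof. by apply/card_set_bijP; rewrite card_eq_sym; exact: card_nat2. Qed.

(** * Estimates for sine and cosine *)

Lemma sin_cos_lipschitz (R : realType) (b : bool) (x y : R) :
  `|(if b then sin else cos) y - (if b then sin else cos) x| <= `|y - x|.
Proof.
wlog le_xy : x y / x <= y => [h|].
  by have [/h//|/ltW/h] := leP x y; rewrite distrC (distrC y).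
pose df : R -> R := if b then cos else (fun z => - sin z).
have [c _ ->] : exists2 c, c \in `[x, y] &
    (if b then sin else cos) y - (if b then sin else cos) x = df c * (y - x).
  apply: MVT_segment => //.
  - by move=> z _; rewrite /df; case: b {df}; exact: _.
  - apply: continuous_subspaceT => z.
    by case: b {df}; [exact: continuous_sin|exact: continuous_cos].
rewrite normrM ler_piMl// /df.
by case: b {df}; rewrite ?normrN ?cos_max ?sin_max.
Qed.

(** With u = (y - x) / 2, the squares of the two differences add up to 4 sin(u)^2. As |u| <= 1/2,
    this is at least |y - x|^2 / 2, so the differences cannot both be below |y - x| / 2. *)
Lemma chord_ge (R : realType) (x y : R) : `|y - x| <= 1 ->
  exists b : bool, `|y - x| / 2 <=
    `|(if b then sin else cos) y - (if b then sin else cos) x|.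
Proof.
set u := (y - x) / 2 => le1.
have cosE2 (z : R) : cos z = 1 - 2 * sin (z / 2) ^+ 2.
  have {1}-> : z = (z / 2) *+ 2 by rewrite -mulr_natr; field.
  by rewrite cos_mulr2n; have := cos2Dsin2 (z / 2); lra.
have sin_sqr_le (z : R) : sin z ^+ 2 <= z ^+ 2.
  have := @sin_cos_lipschitz R true 0 z; rewrite /= sin0 !subr0 => h.
  by rewrite -(real_normK (num_real (sin z))) -(real_normK (num_real z)) lerXn2r// nnegrE.
have sin_sqr_ge : `|y - x| ^+ 2 / 2 <= 4 * sin u ^+ 2.
  have -> : `|y - x| = 2 * `|u| by rewrite /u normrM normfV normr_nat; field.
  have : `|u| <= 2^-1 by rewrite /u normrM normfV normr_nat ler_piMl.
  have -> : sin u ^+ 2 = sin `|u| ^+ 2.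
    by have [_|//] := ler0P u; rewrite sinN sqrrN.
  move: `|u| (normr_ge0 u) => v v0 v1.
  have sin_cont : {within `[0, v], continuous (@sin R)}.
    by apply: continuous_subspaceT => z; exact: continuous_sin.
  (* This gives sin v = cos c * v with 0 <= c <= v <= 1/2, and cos c = 1 - 2 sin(c/2)^2 >= 1 - c^2/2
     >= 7/8. *)
  have [c] := MVT_segment v0 (fun z _ => is_derive_sin z) sin_cont.
  rewrite in_itv/= sin0 !subr0 => /andP[c0 cv] ->.
  have : 7 / 8 <= cos c.
    by rewrite cosE2; have := sin_sqr_le (c / 2); nra.
  move: (cos c) => w w_ge; have {w_ge} : 1 / 2 <= w ^+ 2 by nra.
  by rewrite !exprMn; have := sqr_ge0 v; nra.
have sqrD : (sin y - sin x) ^+ 2 + (cos y - cos x) ^+ 2 = 4 * sin u ^+ 2.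
  have := cosE2 (y - x); rewrite -/u cosB.
  by have := cos2Dsin2 x; have := cos2Dsin2 y; nra.
have [sin_lt|?] := ltP `|sin y - sin x| (`|y - x| / 2); last by exists true.
exists false; rewrite leNgt; apply/negP => cos_lt.
move: sqrD sin_sqr_ge; rewrite -(real_normK (num_real (_ - sin x))).
rewrite -(real_normK (num_real (_ - cos x))).
move: (normr_ge0 (sin y - sin x)) (normr_ge0 (cos y - cos x)) sin_lt cos_lt.
by move: `|sin y - sin x| `|cos y - cos x| `|y - x| => p q r; nra.
Qed.

Lemma dyadic_bracket (R : realType) (d : R) : 0 < d -> d <= 1 ->
  exists n : nat, 1 / 2 ^+ n.+1 <= d <= 1 / 2 ^+ n.
Proof.
move=> d_gt0 d_le1.
have ex_le : exists n : nat, 1 / 2 ^+ n.+1 <= d.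
  exists (Num.bound d^-1); rewrite ler_pdivrMr ?exprn_gt0//.
  rewrite mulrC -ler_pdivrMr// mul1r ltW//.
  exact: upper_nthrootP.
(* The least such exponent works: for n = 0 the upper bound is [d_le1], and otherwise its failure
   would make the predecessor a smaller candidate. *)
case: (ex_minnP ex_le) => -[|n] d_ge min_n; [exists 0%N|exists n.+1].
  by rewrite d_ge divr1.
rewrite d_ge leNgt; apply/negP => /ltW/min_n.
by rewrite ltnn.
Qed.

(** * Points of the unit cube and the relation [Erel] *)

Definition unit_elt (R : realType) (r : R) (r01 : r \in `[0, 1]) :
  set_type (`[0, 1] : set R) := exist _ r (mem_set r01).

Lemma set_val_in01 (R : realType) (u : set_type (`[0, 1] : set R)) :
  set_val u \in `[0, 1].
Proof. exact: (set_valP u). Qed.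

Lemma Erel_seq (R : realType) (g : R -> R) (u v : nat -> R)
    (u01 : forall n, u n \in `[0, 1]) (v01 : forall n, v n \in `[0, 1]) :
  Erel g (fun n => unit_elt (u01 n)) (fun n => unit_elt (v01 n)) =
  (\sum_(0 <= n <oo) (g `|v n - u n|)%:E < +oo)%E.
Proof. by []. Qed.

(** The constant sequence 0 is related to itself, so the series with all terms [g 0] converges and
    its terms tend to 0. *)
Lemma Erel_refl0 (R : realType) (g : R -> R) : {in `[0, 1], forall x, 0 <= g x} ->
  Equivalence (Erel g) -> g 0 = 0.
Proof.
move=> g_ge0 [refl_g _ _].
have in0 : (0 : R) \in `[0, 1] by rewrite in_itv/= lexx ler01.
have := refl_g (fun n => unit_elt in0); rewrite (@Erel_seq _ g (fun=> 0) (fun=> 0)).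
rewrite subrr normr0 => g_fin.
have /nnseries_is_cvg : forall i : nat, 0 <= g 0 by move=> _; exact: g_ge0.
move=> /(_ g_fin)/cvg_series_cvg_0/cvg_lim.
by rewrite lim_cst//; apply.
Qed.

(** * The doubling property *)

Lemma nneseries_block (R : realType) (c : R) (N : nat) : 0 <= c ->
  (\sum_(0 <= i <oo) (if (i < N)%N then c else 0)%:E = (c *+ N)%:E)%E.
Proof.
move=> c_ge0; rewrite (nneseries_split 0 N); last first.
  by move=> k _; rewrite lee_fin; case: ifP.
rewrite add0n [X in (_ + X)%E]eseries0 ?adde0; last first.
  by move=> i Ni _; rewrite ltnNge Ni.
rewrite (eq_big_nat _ _ (F2 := fun=> c%:E)); last by move=> i /andP[_ ->].
by rewrite sumEFin sumr_const_nat subn0.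
Qed.

(* If g (t_k) > 2^k g (t_k / 2) for all k, repeat t_k about 1 / g (t_k) times: the
   resulting sequence t is not equivalent to 0, but t / 2 is equivalent to both. *)
Lemma Erel_doubling (R : realType) (g : R -> R) :
  {in `[0, 1], forall x, 0 <= g x} -> essentially_increasing g ->
  Equivalence (Erel g) ->
  exists2 D : R, 1 <= D & {in `[0, 1], forall t, g t <= D * g (t / 2)}.
Proof.
move=> g_ge0 [C C1 g_incr] Eg; have g0 := Erel_refl0 g_ge0 Eg.
apply: contrapT => no_D.
have /choice[t t_spec] (k : nat) : exists t : R,
    t \in `[0, 1] /\ 2 ^+ k * g (t / 2) < g t.
  apply: contrapT => no_t; apply: no_D; exists (2 ^+ k).
    by rewrite exprn_ege1// ler1n.
  move=> t t01; rewrite leNgt; apply/negP => lt_t.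
  by apply: no_t; exists t.
have t01 k : t k \in `[0, 1] by case: (t_spec k).
have half01 (r : R) : r \in `[0, 1] -> r / 2 \in `[0, 1].
  by rewrite !in_itv/=; lra.
have gt_pos k : 0 < g (t k).
  case: (t_spec k) => _; apply: le_lt_trans.
  by rewrite mulr_ge0 ?exprn_ge0// g_ge0// half01.
pose M := C * g 1.
have g_leM r : r \in `[0, 1] -> g r <= M.
  move=> r01; apply: g_incr => //; first by rewrite in_itv/= lexx ler01.
  by move: r01; rewrite in_itv/= => /andP[].
(* [N k] exceeds [1 / g (t k)], but by at most 1: a block of [N k] copies of [t k] has [g]-sum at
   least 1, while the block of halves stays small. *)
pose N k := Num.bound (g (t k))^-1.
have N_gt k : 1 <= g (t k) *+ N k.
  rewrite -mulr_natr -ler_pdivrMl// mulr1 ltW// archi_boundP//.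
  by rewrite invr_ge0 ltW.
have N_le k : (N k)%:R <= (g (t k))^-1 + 1.
  rewrite /N /Num.bound ger0_norm ?invr_ge0 ?(ltW (gt_pos k))//.
  have /truncn_itv/andP[le_inv _] : 0 <= (g (t k))^-1 by rewrite invr_ge0 ltW.
  by rewrite -natr1 lerD2r.
have M_ge0 : 0 <= M by rewrite (le_trans (ltW (gt_pos 0)))// g_leM.
(* The block of halves is at most 2^-k g(t_k) (1/g(t_k) + 1) <= 2^-k (1 + M). The extra factor 2 and
   the exponent k + 1 fit the form of [cvg_geometric_eseries_half]. *)
have block_le k : g (t k / 2) *+ N k <= (2 * (1 + M)) / (2 ^ (k + 1))%:R.
  have [_ lt_gt] := t_spec k.
  rewrite ler_pdivlMr ?ltr0n ?expn_gt0// natrX addn1 exprS -(mulr_natr (g _)).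
  have gh_ge0 : 0 <= g (t k / 2) by rewrite g_ge0// half01.
  have -> : g (t k / 2) * (N k)%:R * (2 * 2 ^+ k) =
      2 * (2 ^+ k * g (t k / 2) * (N k)%:R) by ring.
  rewrite ler_pM2l//.
  apply: (@le_trans _ _ (g (t k) * ((g (t k))^-1 + 1))).
    by apply: ler_pM => //; [rewrite mulr_ge0 ?exprn_ge0|exact: ltW].
  by rewrite mulrDr mulr1 divff ?gt_eqF// lerD2l g_leM.
have [e e_bij] := nat2_bij.
(* Row k of the pairs coded by [e] holds [N k] copies of [w k], padded with zeros, which add nothing
   because [g 0 = 0]. *)
pose blk (w : nat -> R) (m : nat) : R :=
  if ((e m).2 < N (e m).1)%N then w (e m).1 else 0.
have in0 : (0 : R) \in `[0, 1] by rewrite in_itv/= lexx ler01.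
have blk01 (w : nat -> R) : (forall k, w k \in `[0, 1]) ->
  forall m, blk w m \in `[0, 1] by move=> w01 m; rewrite /blk; case: ifP.
have blk_sum (w : nat -> R) : (forall k, w k \in `[0, 1]) ->
    (\sum_(0 <= m <oo) (g (blk w m))%:E =
     \sum_(0 <= k <oo) (g (w k) *+ N k)%:E)%E.
  move=> w01.
  rewrite -(eq_eseriesr (fun k _ => nneseries_block (N k) (g_ge0 _ (w01 k)))).
  rewrite -(@nneseries_pair _ e) => //.
    by apply: eq_eseriesr => m _; rewrite /blk (fun_if g) g0.
  by move=> k i; rewrite lee_fin; case: ifP => // _; exact: g_ge0.
have th01 k : t k / 2 \in `[0, 1] by exact: half01.
(* As t - t/2 = t/2, the series comparing the halves with [t] is the one comparing 0 with the
   halves; [fin_half] thus serves both premises of transitivity. *)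
have tht : forall m, blk t m - blk (fun k => t k / 2) m = blk (fun k => t k / 2) m.
  by move=> m; rewrite /blk; case: ifP => _; [field|rewrite subr0].
have norm01 (r : R) : r \in `[0, 1] -> `|r| = r.
  by rewrite in_itv/= => /andP[? _]; rewrite ger0_norm.
have fin_half : (\sum_(0 <= m <oo) (g (blk (fun k => t k / 2) m))%:E < +oo)%E.
  rewrite blk_sum//.
  apply: (@le_lt_trans _ _ (2 * (1 + M) / 2 ^+ 0)%:E); last exact: ltry.
  rewrite -(cvg_lim _ (@cvg_geometric_eseries_half R (2 * (1 + M)) 0))//.
  apply: lee_nneseries => [k _ _|k _]; rewrite lee_fin//.
  by rewrite mulrn_wge0// g_ge0.
have [_ _ trans_g] := Eg.
have := trans_g (fun=> unit_elt in0) (fun m => unit_elt (blk01 _ th01 m))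
  (fun m => unit_elt (blk01 _ t01 m)).
rewrite (Erel_seq _ (fun=> in0)) (Erel_seq _ (fun=> in0)) Erel_seq.
under eq_eseriesr do rewrite subr0 norm01 ?blk01//.
under [X in _ -> (X < _)%E -> _]eq_eseriesr do rewrite tht norm01 ?blk01//.
under [X in _ -> _ -> (X < _)%E]eq_eseriesr do rewrite subr0 norm01 ?blk01//.
move=> /(_ fin_half fin_half); rewrite blk_sum// => sum_fin.
(* Convergence forces the block sums to tend to 0, although each is at least 1 by [N_gt]. *)
have /nnseries_is_cvg/(_ sum_fin)/cvg_series_cvg_0 : forall k, 0 <= g (t k) *+ N k.
  by move=> k; rewrite mulrn_wge0// g_ge0.
move=> /cvgrPdist_lt/(_ 1 ltr01)[k _ /(_ k (leqnn k))] /=.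
by rewrite sub0r normrN ger0_norm ?mulrn_wge0 ?g_ge0// ltNge N_gt.
Qed.

(** * Rescaled sines and cosines, interleaved by parity *)

Definition wave (R : realType) (j : nat) (x : R) : R :=
  (1 + (if odd j then sin else cos) (2 ^+ j./2 * x)) / 2.

Lemma wave01 (R : realType) j (x : R) : wave j x \in `[0, 1].
Proof.
rewrite in_itv/= /wave; case: (odd j).
  by have := sin_geN1 (2 ^+ j./2 * x); have := sin_le1 (2 ^+ j./2 * x); lra.
by have := cos_geN1 (2 ^+ j./2 * x); have := cos_le1 (2 ^+ j./2 * x); lra.
Qed.

Lemma continuous_wave (R : realType) j : continuous (@wave R j).
Proof.
move=> x; apply: cvgM; last exact: cvg_cst.
apply: cvgD; first exact: cvg_cst.
apply: (continuous_comp (f := fun z : R => 2 ^+ j./2 * z)).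
  by apply: cvgM; [exact: cvg_cst|exact: cvg_id].
by case: (odd j); [exact: continuous_sin|exact: continuous_cos].
Qed.

Lemma waveB_norm (R : realType) j (x y : R) : `|wave j y - wave j x| =
  `|(if odd j then sin else cos) (2 ^+ j./2 * y) -
    (if odd j then sin else cos) (2 ^+ j./2 * x)| / 2.
Proof.
rewrite -[X in _ = _ / X]normr_nat -normf_div; congr `|_|.
by rewrite /wave; field.
Qed.

Lemma wave_lipschitz (R : realType) j (x y : R) :
  `|wave j y - wave j x| <= 2 ^+ j./2 * `|y - x|.
Proof.
rewrite waveB_norm ler_pdivrMr//.
apply: le_trans (sin_cos_lipschitz _ _ _) _.
rewrite -mulrBr normrM ger0_norm ?exprn_ge0//.
by rewrite ler_peMr ?mulr_ge0 ?exprn_ge0// ler1n.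
Qed.

(** The factor 1/4 combines the 1/2 of [chord_ge], applied to the points scaled by 2^i, with the 1/2
    that brings the waves into [0,1]. *)
Lemma wave_separation (R : realType) i (x y : R) : 2 ^+ i * `|y - x| <= 1 ->
  exists b : bool,
    2 ^+ i * `|y - x| / 4 <= `|wave (b + i.*2) y - wave (b + i.*2) x|.
Proof.
have normE : 2 ^+ i * `|y - x| = `|2 ^+ i * y - 2 ^+ i * x|.
  by rewrite -mulrBr normrM ger0_norm ?exprn_ge0.
rewrite normE => /chord_ge[b le_chord]; exists b.
rewrite waveB_norm half_bit_double oddD odd_double addbF oddb.
by move: le_chord; lra.
Qed.

Lemma sum_nat_double (V : nmodType) (F : nat -> V) n :
  \sum_(0 <= j < n.*2) F j = \sum_(0 <= i < n) (F i.*2 + F i.*2.+1).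
Proof.
by elim: n => [|n IH]; rewrite ?big_nil// doubleS !big_nat_recr//= IH addrA.
Qed.

(** Each i equals [j./2] for exactly two j, namely 2i and 2i + 1; these are the cosine and the sine
    of one frequency. *)
Lemma nneseries_half_le (R : realType) (a : nat -> \bar R) :
  (forall i, (0 <= a i)%E) ->
  (\sum_(0 <= j <oo) a j./2 <= 2%:E * \sum_(0 <= i <oo) a i)%E.
Proof.
move=> a_ge0; apply: lime_le; first by apply: is_cvg_nneseries => j _ _.
apply: nearW => n; apply: (@le_trans _ _ (\sum_(0 <= j < n.*2) a j./2)%E).
  by apply: lee_sum_nneg_natr => //; rewrite -addnn leq_addr.
rewrite sum_nat_double.
under eq_bigr => i _ do rewrite doubleK -[i.*2.+1]/(true + i.*2)%N half_bit_double.
by rewrite big_split/= mule_natl mule2n leeD// nneseries_lim_ge.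
Qed.

(** * Comparison of the wave series with [f] *)

Section wave_sums.
Variables (R : realType) (g : R -> R) (C : R) (kap : nat -> R).
Hypothesis g_ge0 : {in `[0, 1], forall x : R, 0 <= g x}.
Hypothesis C_ge1 : 1 <= C.
Hypothesis g_incr : {in `[0, 1] &, forall x y : R, x <= y -> g x <= C * g y}.
Hypothesis kap01 : forall i, kap i \in `[0, 1].

Let kap_ge0 i : 0 <= kap i.
Proof. by have := kap01 i; rewrite in_itv/= => /andP[]. Qed.

Let kap_le1 i : kap i <= 1.
Proof. by have := kap01 i; rewrite in_itv/= => /andP[]. Qed.

Let C_ge0 : 0 <= C. Proof. exact: le_trans C_ge1. Qed.

Definition osc (x y : R) (j : nat) : R :=
  `|kap j./2 * wave j y - kap j./2 * wave j x|.

Lemma oscE x y j : osc x y j = kap j./2 * `|wave j y - wave j x|.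
Proof. by rewrite /osc -mulrBr normrM ger0_norm. Qed.

Lemma osc_le_kap x y j : osc x y j <= kap j./2.
Proof.
rewrite oscE ler_piMr//.
have := wave01 j x; have := wave01 j y.
by rewrite !in_itv/= ler_norml => /andP[? ?] /andP[? ?]; apply/andP; split; lra.
Qed.

Lemma osc01 x y j : osc x y j \in `[0, 1].
Proof. by rewrite in_itv/= (le_trans (osc_le_kap _ _ _))// /osc normr_ge0. Qed.

Let kap_div01 i m : kap i / 2 ^+ m \in `[0, 1].
Proof.
rewrite in_itv/= divr_ge0 ?exprn_ge0//= ler_pdivrMr ?exprn_gt0//.
by rewrite mul1r (le_trans (kap_le1 i))// exprn_ege1// ler1n.
Qed.

(** Frequencies i <= n are bounded by the Lipschitz estimate, those above by the amplitude [kap i].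
    Passing through [g] costs [C], and the pairing of sine and cosine costs 2. *)
Lemma nneseries_osc_le n x y : `|y - x| <= 1 / 2 ^+ n ->
  (\sum_(0 <= j <oo) (g (osc x y j))%:E <=
   (2 * C)%:E * ((\sum_(0 <= i < n.+1) g (kap i / 2 ^+ (n - i)))%:E +
                 \sum_(n <= i <oo) (g (kap i))%:E))%E.
Proof.
move=> xy_le.
pose b i := if (i <= n)%N then g (kap i / 2 ^+ (n - i)) else g (kap i).
have b_ge0 i : 0 <= b i by rewrite /b; case: ifP => _; rewrite g_ge0.
have osc_le j : g (osc x y j) <= C * b j./2.
  rewrite /b; case: ifP => [jn|_]; apply: g_incr; rewrite ?osc01 ?kap_div01//.
    rewrite oscE; apply: ler_wpM2l => //; apply: le_trans (wave_lipschitz _ _ _) _.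
    rewrite -div1r ler_pdivlMr ?exprn_gt0// mulrAC -exprD subnKC//.
    by rewrite mulrC -ler_pdivlMr ?exprn_gt0.
  exact: osc_le_kap.
apply: (@le_trans _ _ (\sum_(0 <= j <oo) (C%:E * (b j./2)%:E))%E).
  by apply: lee_nneseries => [j _ _|j _]; rewrite lee_fin ?g_ge0 ?osc01.
rewrite nneseriesZl//; last by move=> j _; rewrite lee_fin.
rewrite mulrC EFinM -muleA lee_wpmul2l ?lee_fin//.
apply: (le_trans (@nneseries_half_le _ (fun i => (b i)%:E) _)).
  by move=> i; rewrite lee_fin.
rewrite lee_wpmul2l ?lee_fin// (nneseries_split 0 n.+1); last by move=> i _; rewrite lee_fin.
rewrite add0n -sumEFin leeD//.
  rewrite le_eqVlt; apply/orP; left; apply/eqP; apply: eq_big_nat => i /andP[_].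
  by rewrite ltnS /b => ->.
(* The majorant has its tail from n + 1, the statement from n, the form in which tails are bounded
   later; the additional term is nonnegative. *)
rewrite [leRHS](nneseries_split n 1); last by move=> i _; rewrite lee_fin g_ge0.
rewrite addn1 big_nat1 -[leLHS]add0e leeD ?lee_fin ?g_ge0//.
rewrite eseries_cond [leRHS]eseries_cond.
apply: lee_nneseries => [i _ _|i /=]; first by rewrite lee_fin.
by rewrite /b ltnNge => /negbTE ->.
Qed.

(** For i <= n one wave of frequency 2^i moves by at least 2^i |y - x| / 4, and |y - x| >= 2^-(n+1).
    So its scaled move is at least an eighth of kap_i / 2^(n-i), whence three doublings and the
    factor D^3. *)
Lemma nneseries_osc_ge (D : R) n x y : 0 <= D ->
  {in `[0, 1], forall t, g t <= D * g (t / 2)} ->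
  1 / 2 ^+ n.+1 <= `|y - x| <= 1 / 2 ^+ n ->
  ((\sum_(0 <= i < n.+1) g (kap i / 2 ^+ (n - i)))%:E <=
   (D ^+ 3 * C)%:E * \sum_(0 <= j <oo) (g (osc x y j))%:E)%E.
Proof.
move=> D_ge0 g_dbl /andP[xy_ge xy_le].
have g_dbl3 t : t \in `[0, 1] -> g t <= D ^+ 3 * g (t / 8).
  move=> t01; have h01 (r : R) : r \in `[0, 1] -> r / 2 \in `[0, 1].
    by rewrite !in_itv/=; lra.
  have -> : D ^+ 3 * g (t / 8) = D * (D * (D * g (t / 2 / 2 / 2))).
    by rewrite (_ : t / 8 = t / 2 / 2 / 2); [ring|field].
  apply: le_trans (g_dbl _ t01) _; apply: ler_wpM2l => //.
  apply: le_trans (g_dbl _ (h01 _ t01)) _; apply: ler_wpM2l => //.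
  exact: (g_dbl _ (h01 _ (h01 _ t01))).
have osc_ge0 j : 0 <= g (osc x y j) by rewrite g_ge0// osc01.
apply: (@le_trans _ _ ((D ^+ 3 * C)%:E *
    \sum_(0 <= j < n.+1.*2) (g (osc x y j))%:E)%E); last first.
  rewrite lee_wpmul2l ?lee_fin ?mulr_ge0 ?exprn_ge0//.
  by apply: nneseries_lim_ge => j _; rewrite lee_fin.
rewrite sumEFin sum_nat_double -EFinM lee_fin mulr_sumr.
apply: ler_sum_nat => i; rewrite ltnS => /andP[_ le_in].
apply: le_trans (g_dbl3 _ (kap_div01 _ _)) _.
rewrite -[leRHS]mulrA ler_wpM2l ?exprn_ge0//.
have pow_xy : 2 ^+ i * `|y - x| <= 1.
  apply: (@le_trans _ _ (2 ^+ i * (1 / 2 ^+ i))).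
    rewrite ler_wpM2l ?exprn_ge0//; apply: le_trans xy_le _.
    rewrite ler_pdivlMr ?exprn_gt0// mulrC mulrA mulr1 ler_pdivrMr ?exprn_gt0//.
    by rewrite mul1r ler_weXn2l// ler1n.
  by rewrite mulrC mulfVK ?expf_neq0.
have [b b_sep] := wave_separation pow_xy.
(* Of the two terms of frequency 2^i only the separated one is kept; the other is nonnegative. *)
apply: (@le_trans _ _ (C * g (osc x y (b + i.*2)))); last first.
  rewrite ler_wpM2l//; case: (b) => /=; rewrite ?add0n ?add1n.
    by rewrite lerDr.
  by rewrite lerDl.
apply: g_incr; rewrite ?osc01//.
  by move: (kap_div01 i (n - i)); rewrite !in_itv/=; lra.
rewrite oscE half_bit_double -!mulrA ler_wpM2l//.
apply: le_trans b_sep.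
rewrite ler_pdivlMr// -(@ler_pM2l _ (2 ^+ i)^-1) ?invr_gt0 ?exprn_gt0//.
rewrite mulKf ?expf_neq0//; apply: le_trans xy_ge.
rewrite div1r -[n in leRHS](subnKC le_in) exprS exprD !invfM.
by move: (2 ^- i) (2 ^- (n - i)) => p q; lra.
Qed.

Lemma nneseries_osc_comparable (D : R) (f : R -> R) (Cf Df L : R) :
  0 <= D -> {in `[0, 1], forall t, g t <= D * g (t / 2)} -> g 0 = 0 ->
  {in `[0, 1], forall x : R, 0 <= f x} -> f 0 = 0 ->
  0 <= Cf -> {in `[0, 1] &, forall x y : R, x <= y -> f x <= Cf * f y} ->
  0 <= Df -> {in `[0, 1], forall t, f t <= Df * f (t / 2)} -> 0 <= L ->
  (forall n : nat,
    f (1 / 2 ^+ n) = \sum_(0 <= i < n.+1) g (kap i / 2 ^+ (n - i))) ->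
  (forall n : nat, (\sum_(n <= i <oo) (g (kap i))%:E <=
    (L * \sum_(0 <= i < n.+1) g (kap i / 2 ^+ (n - i)))%:E)%E) ->
  exists2 K : R, 0 <= K & forall x y, `|y - x| <= 1 ->
    (\sum_(0 <= j <oo) (g (osc x y j))%:E <= K%:E * (f `|y - x|)%:E)%E /\
    ((f `|y - x|)%:E <= K%:E * \sum_(0 <= j <oo) (g (osc x y j))%:E)%E.
Proof.
move=> D_ge0 g_dbl g0 f_ge0 f0 Cf_ge0 f_incr Df_ge0 f_dbl L_ge0 f_pow tail_le.
have pow01 n : (1 : R) / 2 ^+ n \in `[0, 1].
  rewrite in_itv/= divr_ge0 ?exprn_ge0//= ler_pdivrMr ?exprn_gt0//.
  by rewrite mul1r exprn_ege1// ler1n.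
(* In [K1], 2C comes from [nneseries_osc_le], 1 + L from the head and the tail, and Df * Cf from
   going down from f(2^-n) to f(2^-(n+1)) and then to f(|y - x|). In [K2], Cf bounds f(|y - x|) by
   f(2^-n), and the rest is [nneseries_osc_ge]. *)
pose K1 := 2 * C * (1 + L) * (Df * Cf); pose K2 := Cf * (D ^+ 3 * C).
have K1_ge0 : 0 <= K1 by rewrite !mulr_ge0// addr_ge0.
have K2_ge0 : 0 <= K2 by rewrite !mulr_ge0 ?exprn_ge0.
exists (K1 + K2); first by rewrite addr_ge0.
move=> x y xy_le1.
have osc_sum_ge0 : (0 <= \sum_(0 <= j <oo) (g (osc x y j))%:E)%E.
  by apply: nneseries_ge0 => j _ _; rewrite lee_fin g_ge0 ?osc01.
have d01 : `|y - x| \in `[0, 1] by rewrite in_itv/= normr_ge0.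
have f_d_ge0 := f_ge0 _ d01.
suff [le1 le2] : (\sum_(0 <= j <oo) (g (osc x y j))%:E <= (K1 * f `|y - x|)%:E)%E
    /\ ((f `|y - x|)%:E <= K2%:E * \sum_(0 <= j <oo) (g (osc x y j))%:E)%E.
  split.
    by apply: le_trans le1 _; rewrite -EFinM lee_fin ler_wpM2r// lerDl.
  by apply: le_trans le2 _; rewrite lee_wpmul2r// lee_fin lerDr.
(* Equal points lie in no dyadic bracket; there both sides vanish because [f 0 = g 0 = 0]. *)
have [xy0|xy_neq0] := eqVneq x y.
  have osc0 j : osc x y j = 0 by rewrite oscE xy0 subrr normr0 mulr0.
  rewrite eseries0 ?mule0; last by move=> j _ _; rewrite osc0 g0.
  by rewrite xy0 subrr normr0 f0 mulr0.
have d_gt0 : 0 < `|y - x| by rewrite normr_gt0 subr_eq0 eq_sym.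
have [n /andP[d_ge d_le]] := dyadic_bracket d_gt0 xy_le1.
split.
  apply: le_trans (nneseries_osc_le d_le) _.
  apply: (@le_trans _ _ ((2 * C)%:E * ((1 + L) * f (1 / 2 ^+ n))%:E)%E).
    rewrite lee_wpmul2l ?lee_fin ?mulr_ge0// mulrDl mul1r f_pow EFinD.
    by rewrite leeD2l.
  rewrite -EFinM lee_fin.
  have -> : K1 * f `|y - x| = 2 * C * ((1 + L) * (Df * (Cf * f `|y - x|))).
    by rewrite /K1; ring.
  apply: ler_wpM2l; first by rewrite mulr_ge0.
  apply: ler_wpM2l; first by rewrite addr_ge0.
  apply: le_trans (f_dbl _ (pow01 n)) _; apply: ler_wpM2l => //.
  have -> : 1 / 2 ^+ n / 2 = 1 / 2 ^+ n.+1 :> R by rewrite exprSr invfM mulrA.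
  exact: f_incr.
apply: (@le_trans _ _ (Cf%:E * (f (1 / 2 ^+ n))%:E)%E).
  by rewrite -EFinM lee_fin f_incr.
rewrite EFinM -muleA lee_wpmul2l ?lee_fin// f_pow.
by apply: nneseries_osc_ge; rewrite ?d_ge.
Qed.

End wave_sums.

(** * Continuity and Borel measurability *)

Lemma continuous_borel_fun (X Y : topologicalType) (h : X -> Y) :
  continuous h -> borel_fun h.
Proof.
move=> h_cont B; apply: (@smallest_sub _ _ _ [set B | <<s open >> (h @^-1` B)]).
  split => /= [|A|A].
  - by rewrite preimage_set0; exact: sigma_algebra0.
  - exact: sigma_algebraCD.
  - by rewrite preimage_bigcup => hA; exact: sigma_algebra_bigcup.
by move=> A oA; apply: sub_sigma_algebra; move/continuousP: h_cont; exact.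
Qed.

(** Product and subspace topologies are both initial, so continuity reduces to that of each real
    coordinate [h m]. *)
Lemma continuous_unit_cube (R : realType) (X : topologicalType)
    (h : nat -> X -> R) (h01 : forall m x, h m x \in `[0, 1]) :
  (forall m, continuous (h m)) ->
  continuous (fun x => (fun m => unit_elt (h01 m x)) : unit_cube R).
Proof.
move=> h_cont x; apply/cvg_sup => m.
have := @continuous_comp_initial _ X (set_type (`[0, 1] : set R))
  (fun f : forall _ : nat, set_type (`[0, 1] : set R) => f m)
  (fun x m => unit_elt (h01 m x)).
move=> /(_ _ x); apply => {}x.
have := @continuous_comp_initial _ X R (@set_val _ (`[0, 1] : set R))
  (fun x => unit_elt (h01 m x)).
by move=> /(_ _ x); apply; exact: h_cont.
Qed.

Lemma continuous_coord (R : realType) n :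
  continuous (fun x : unit_cube R => set_val (x n)).
Proof.
move=> x; apply: continuous_comp; last exact: initial_continuous.
exact: (@proj_continuous nat (fun=> set_type (`[0, 1] : set R)) n).
Qed.

(** * The reduction *)

Unset Implicit Arguments.
Set Strict Implicit.

Theorem theorem16 (R : realType) (f g : R -> R)
  (f_ge0 : {in `[0, 1], forall x : R, 0 <= f x})
  (g_ge0 : {in `[0, 1], forall x : R, 0 <= g x})
  (f_cont : {within `[0, 1], continuous f})
  (g_cont : {within `[0, 1], continuous g})
  (f_incr : essentially_increasing f)
  (g_incr : essentially_increasing g)
  (Ef_equiv : Equivalence (Erel f))
  (Eg_equiv : Equivalence (Erel g))
  (kappa : R -> R)
  (kappa01 : forall i : nat, kappa (1 / 2 ^+ i) \in `[0, 1])
  (f_one : f 1 = g (kappa 1))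
  (f_pow : forall n : nat, (0 < n)%N ->
    f (1 / 2 ^+ n) =
      \sum_(0 <= i < n.+1) g (kappa (1 / 2 ^+ i) / 2 ^+ (n - i)))
  (L : R) (L_ge1 : 1 <= L)
  (tail_le : forall n : nat,
    (\sum_(n <= i <oo) (g (kappa (1 / 2 ^+ i)))%:E <=
      (L * \sum_(0 <= i < n.+1) g (kappa (1 / 2 ^+ i) / 2 ^+ (n - i)))%:E)%E)
  (kappa_le : forall n : nat, (0 < n)%N ->
    kappa (1 / 2 ^+ n) <=
      L * \big[Num.max/0]_(0 <= i < n) (kappa (1 / 2 ^+ i) / 2 ^+ (n - i))) :
  borel_reducible (Erel f) (Erel g).
Proof.
pose kap (i : nat) := kappa (1 / 2 ^+ i).
have [D D_ge1 g_dbl] := Erel_doubling g_ge0 g_incr Eg_equiv.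
have [Df Df_ge1 f_dbl] := Erel_doubling f_ge0 f_incr Ef_equiv.
have f0 := Erel_refl0 f_ge0 Ef_equiv; have g0 := Erel_refl0 g_ge0 Eg_equiv.
case: f_incr g_incr => Cf Cf_ge1 f_incr [C C_ge1 g_incr].
have ge1_ge0 (r : R) : 1 <= r -> 0 <= r by exact: le_trans.
have f_pow_all n :
    f (1 / 2 ^+ n) = \sum_(0 <= i < n.+1) g (kap i / 2 ^+ (n - i)).
  case: n => [|n]; last exact: f_pow.
  by rewrite big_nat1 expr0 !divr1 f_one /kap expr0 divr1.
have [K K_ge0 cmp] := nneseries_osc_comparable g_ge0 C_ge1 g_incr kappa01
  (ge1_ge0 _ D_ge1) g_dbl g0 f_ge0 f0 (ge1_ge0 _ Cf_ge1) f_incr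
  (ge1_ge0 _ Df_ge1) f_dbl (ge1_ge0 _ L_ge1) f_pow_all tail_le.
have [e e_bij] := nat2_bij.
(* The code [e m] is a pair (n, j): wave j is applied to coordinate n of [x] and scaled by the
   amplitude of its frequency. *)
pose coord m (x : unit_cube R) :=
  kap (e m).2./2 * wave (e m).2 (set_val (x (e m).1)).
have coord01 m x : coord m x \in `[0, 1].
  have := kappa01 (e m).2./2; have := wave01 (e m).2 (set_val (x (e m).1)).
  rewrite !in_itv/= => /andP[w0 w1] /andP[k0 k1].
  by rewrite /coord mulr_ge0// mulr_ile1.
exists (fun x => (fun m => unit_elt (coord01 m x)) : unit_cube R).
  apply: continuous_borel_fun; apply: continuous_unit_cube => m x.
  suff wave_cvg : {for x, continuous (fun x : unit_cube R =>
      wave (e m).2 (set_val (x (e m).1)))} 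
    by apply: cvgM wave_cvg; exact: cvg_cst.
  apply: (continuous_comp (f := fun x : unit_cube R => set_val (x (e m).1))
    (g := @wave R (e m).2)); last exact: continuous_wave.
  exact: continuous_coord.
move=> x y; rewrite Erel_seq.
pose d n := `|set_val (y n) - set_val (x n)|.
have d_le1 n : d n <= 1.
  have := set_val_in01 (x n); have := set_val_in01 (y n).
  by rewrite !in_itv/= /d ler_norml => /andP[? ?] /andP[? ?]; apply/andP; split; lra.
have f_d_ge0 n : (0 <= (f (d n))%:E)%E.
  by rewrite lee_fin f_ge0// in_itv/= /d normr_ge0 d_le1.
pose s n := (\sum_(0 <= j <oo) (g (osc kap (set_val (x n)) (set_val (y n)) j))%:E)%E.
have g_osc_ge0 n j : (0 <= (g (osc kap (set_val (x n)) (set_val (y n)) j))%:E)%E.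
  by rewrite lee_fin g_ge0// osc01.
have s_ge0 n : (0 <= s n)%E by apply: nneseries_ge0.
(* Decoding m turns the series into a double one, whose row n collects the moves caused by
   coordinate n. *)
have -> : (\sum_(0 <= m <oo) (g `|coord m y - coord m x|)%:E =
    \sum_(0 <= n <oo) s n)%E by rewrite -(nneseries_pair e_bij).
have mul_lty (u : \bar R) : (0 <= u -> u < +oo -> K%:E * u < +oo)%E.
  by move=> u_ge0 u_fin; rewrite lte_mul_pinfty.
(* The constant [K] is the same for all coordinates, so the bounds in [cmp] can be summed over n. *)
split=> [f_fin|s_fin].
  apply: (@le_lt_trans _ _ (K%:E * \sum_(0 <= n <oo) (f (d n))%:E)%E).
    rewrite -nneseriesZl//; apply: lee_nneseries => // n _.
    by have [] := cmp _ _ (d_le1 n).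
  by apply: mul_lty => //; exact: nneseries_ge0.
apply: (@le_lt_trans _ _ (K%:E * \sum_(0 <= n <oo) s n)%E).
  rewrite -nneseriesZl//; apply: lee_nneseries => [n _ _|n _].
    exact: f_d_ge0.
  by have [] := cmp _ _ (d_le1 n).
by apply: mul_lty => //; exact: nneseries_ge0.
Qed.
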